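(* Let $F$ be a field, $n\ge 1$, and let $\epsilon,\eta\in T_n(F)$ be primitive idempotents. There exists a bijective linear map $\varphi:T_n(F)\to T_n(F)$ preserving products equal to $\epsilon$ and $\eta$ if and only if $\epsilon$ and $\eta$ have the same diagonal. In this case, any such $\varphi$ is either an automorphism or the negative of an automorphism of the algebra $T_n(F)$.
   Context: $T_n(F)$ is the algebra of upper triangular $n\times n$ matrices over $F$. An idempotent $e$ is primitive if $e=e_1+e_2$ with $e_1,e_2$ orthogonal idempotents ($e_1e_2=e_2e_1=0$) implies $e_1,e_2\in\{0,e\}$. A map $\varphi:A\to B$ between algebras preserves products equal to $a\in A$ and $b\in B$ if for all $a_1,a_2\in A$, $a_1a_2=a$ implies $\varphi(a_1)\varphi(a_2)=b$.
   Formalization: Primitive idempotents are required to be nonzero: the definition as quoted admits 0, and for ε = η = 0 the map 2·id over the rationals preserves zero products but is neither an automorphism nor the negative of one. *)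

(* Defs.v *)
From HB Require Import structures.
From mathcomp Require Import all_boot all_algebra.

Set Implicit Arguments.
Unset Strict Implicit.
Unset Printing Implicit Defensive.

Import GRing.Theory.
Local Open Scope ring_scope.

(* [is_trig_mx] means *lower* triangular (A i j = 0 for i < j), hence the
   transpose. *)
Definition upper_trig_mx (F : fieldType) (n : nat) : {pred 'M[F]_n} :=
  [pred A : 'M[F]_n | is_trig_mx A^T].
Arguments upper_trig_mx : clear implicits.

Lemma upper_trig_mxP (F : fieldType) (n : nat) (A : 'M[F]_n) :
  reflect (forall i j : 'I_n, (j < i)%N -> A i j = 0) (A \in upper_trig_mx F n).
Proof.
apply: (iffP is_trig_mxP) => A0 i j ltij.
  by have := A0 j i ltij; rewrite mxE.
by rewrite mxE; apply: A0.
Qed.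

Lemma upper_trig_mx_subalg (F : fieldType) (n : nat) :
  GRing.subsemialg_closed (upper_trig_mx F n.+1).
Proof.
apply: GRing.subalg_closed_semi; split.
- by apply/upper_trig_mxP => i j ltji; rewrite mxE -val_eqE /= gtn_eqF.
- move=> a A B /upper_trig_mxP A0 /upper_trig_mxP B0.
  apply/upper_trig_mxP => i j ltji.
  by rewrite !mxE A0 // B0 // mulr0 addr0.
- move=> A B /upper_trig_mxP A0 /upper_trig_mxP B0.
  apply/upper_trig_mxP => i j ltji; rewrite mxE big1 // => k _.
  have [ltki|leik] := ltnP k i; first by rewrite A0 // mul0r.
  by rewrite B0 ?mulr0 // (leq_trans ltji).
Qed.

HB.instance Definition _ (F : fieldType) (n : nat) :=
  GRing.isSubalgClosed.Build F 'M[F]_n.+1 (upper_trig_mx F n.+1)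
    (@upper_trig_mx_subalg F n).

(* As for 'M[F]_n, the unital algebra structure is put on T_n(F) for n of the
   form m.+1 only. *)
Record trigmx (F : fieldType) (n : nat) := TrigMx {
  trigmx_val :> 'M[F]_n;
  _ : trigmx_val \in upper_trig_mx F n
}.

Notation "''T[' F ]_ n" := (trigmx F n)
  (at level 8, n at level 2, format "''T[' F ]_ n") : type_scope.

HB.instance Definition _ (F : fieldType) (n : nat) :=
  [isSub for @trigmx_val F n].
HB.instance Definition _ (F : fieldType) (n : nat) :=
  [Choice of 'T[F]_n by <:].
HB.instance Definition _ (F : fieldType) (n : nat) :=
  [SubChoice_isSubNzRing of 'T[F]_n.+1 by <:].
HB.instance Definition _ (F : fieldType) (n : nat) :=
  [SubZmodule_isSubLmodule of 'T[F]_n.+1 by <:].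
HB.instance Definition _ (F : fieldType) (n : nat) :=
  [SubNzRing_SubLmodule_isSubLalgebra of 'T[F]_n.+1 by <:].
HB.instance Definition _ (F : fieldType) (n : nat) :=
  [SubLalgebra_isSubAlgebra of 'T[F]_n.+1 by <:].

Definition idempotent_elt (R : pzRingType) (e : R) : Prop := e * e = e.

(* Primitive idempotents are nonzero, by convention: 0 satisfies the
   indecomposability condition, as e1 + e2 = 0 and e1 * e2 = 0 force e1 = 0. *)
Definition primitive_idempotent (R : pzRingType) (e : R) : Prop :=
  [/\ idempotent_elt e, e != 0 &
      forall e1 e2 : R, idempotent_elt e1 -> idempotent_elt e2 ->
        e1 * e2 = 0 -> e2 * e1 = 0 -> e = e1 + e2 ->
        (e1 = 0 \/ e1 = e) /\ (e2 = 0 \/ e2 = e)].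

Definition preserves_products_equal_to (F : fieldType) (A B : algType F)
    (a : A) (b : B) (phi : A -> B) : Prop :=
  forall a1 a2 : A, a1 * a2 = a -> phi a1 * phi a2 = b.

Definition same_diagonal (F : fieldType) (n : nat) (A B : 'M[F]_n) : Prop :=
  forall i : 'I_n, A i i = B i i.

(* Main.v *)
Require Import Defs.
From HB Require Import structures.
From mathcomp Require Import all_boot all_algebra.

Set Implicit Arguments.
Unset Strict Implicit.
Unset Printing Implicit Defensive.

Import GRing.Theory.
Local Open Scope ring_scope.

(** Write T for the algebra of upper triangular matrices and e_i for its
    diagonal matrix units.

    Idempotents of T with the same diagonal are conjugate: the element
    u = e f + (1 - e)(1 - f) satisfies e u = u f and has unit diagonal, hence
    is invertible. So a primitive idempotent is conjugate to some e_i, equal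
    diagonals give an inner automorphism carrying eps to eta (which preserves
    the required products), and for the converse and for the description of
    phi one may assume that eps = e_i and eta = e_j.

    Let e = e_i and e' = 1 - e. Adding e to two factors a, b with a e = 0,
    e b = 0 and a b = 0 gives again a product equal to e. Comparing images,
    phi a phi b = 0, phi a phi e = 0, phi e phi b = 0 and (phi e)^2 = e_j. Thus
    phi maps the left annihilator of e_i into that of e_j, and likewise on the
    right; comparing dimensions of both annihilators gives j <= i and i <= j
    [diag_unit_matching], and then phi e = e or phi e = - e [image_diag_unit].
    After a change of sign phi fixes e and preserves both annihilators, so it
    preserves the corner C = e' T e'.

    The remaining point is that phi is multiplicative. Since C is spanned by
    idempotents, the preserved zero products give the balance identity
    phi (a c) phi b = phi a phi (c b) for c in C, a e = 0 and e b = 0. Hence phi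
    is multiplicative on C up to the factor z = phi e', which is central and
    invertible in C, so a scalar multiple of e' [corner_center]. The
    factorization (e + x)(e - x + e') = e with x in e T e' forces phi to
    preserve the block e T e' and forces z to act on it as the identity
    [image_peirce_block]; the same holds for e' T e, and as one of the two
    blocks is nonzero whenever C is, z = e'. Finally, for x in e T e' and y in
    e' T e the product y x lies in C, out of reach of zero products; it is
    recovered from a factorization of e that involves both blocks
    [cross_product, image_opposite_blocks]. Additivity over the Peirce
    decomposition then gives phi (a b) = phi a phi b. *)

(** * Maps that preserve factorizations of an idempotent *)

(** The factorizations (a + e)(b + e), (a + e) e, e (b + e) and e e of e have
    the same image, so the cross terms of the expanded images cancel. *)
Lemma factorization_zero_products (R S : pzRingType) (phi : {additive R -> S})
    (e : R) (f : S) (a b : R) :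
    e * e = e -> (forall a b, a * b = e -> phi a * phi b = f) ->
  a * e = 0 -> e * b = 0 -> a * b = 0 ->
  [/\ phi e * phi e = f, phi a * phi e = 0, phi e * phi b = 0
    & phi a * phi b = 0].
Proof.
move=> ee prod ae eb ab.
have Pee : phi e * phi e = f by exact: prod.
have Pae : phi a * phi e = 0.
  apply: (addIr f); rewrite add0r -{1}Pee -mulrDl -raddfD prod //.
  by rewrite mulrDl ae add0r.
have Peb : phi e * phi b = 0.
  apply: (addIr f); rewrite add0r -{1}Pee -mulrDr -raddfD prod //.
  by rewrite mulrDr eb add0r.
split=> //; apply: (addIr f); rewrite add0r -{2}(prod (a + e) (b + e)).
  by rewrite !raddfD mulrDl !mulrDr Pae Peb Pee addr0 add0r.
by rewrite mulrDl !mulrDr ab ae eb ee !add0r.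
Qed.

(** What the abstract part of the argument retains of the situation on
    triangular matrices. The clauses form a self-dual list: the opposite ring
    exchanges the two annihilator clauses and preserves the others, so each
    result on the block e R (1 - e) yields one on (1 - e) R e. *)
Record peirce_preserving (R : pzRingType) (e : R) (phi : {additive R -> R}) :
  Prop := PeircePreserving {
  pp_idem : e * e = e;
  pp_triangular : forall a b, a * e = 0 -> e * b = 0 -> e * (a * b) * e = 0;
  pp_bij : bijective phi;
  pp_fix : phi e = e;
  pp_prod : forall a b, a * b = e -> phi a * phi b = e;
  pp_ann_l : forall a, phi a * e = 0 <-> a * e = 0;
  pp_ann_r : forall a, e * phi a = 0 <-> e * a = 0;
  pp_balanced : forall a b c, a * e = 0 -> e * b = 0 ->
    c * e = 0 -> e * c = 0 -> phi (a * c) * phi b = phi a * phi (c * b) }.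

Lemma peirce_preserving_op (R : pzRingType) (e : R) (phi : {additive R -> R}) :
  peirce_preserving e phi ->
  peirce_preserving (e : R^c) (phi : {additive R^c -> R^c}).
Proof.
case=> ee tri bij fix_e prod annl annr bal; split=> //.
- move=> a b ae eb; have := tri b a eb ae; rewrite -mulrA; exact.
- by move=> a b /prod.
- by move=> a b c ae eb ce ec; apply: esym; exact: (bal b a c).
Qed.

Lemma compl_idl (R : pzRingType) (e a : R) : e * a = 0 -> (1 - e) * a = a.
Proof. by move=> ea; rewrite mulrBl mul1r ea subr0. Qed.

Lemma compl_idr (R : pzRingType) (e a : R) : a * e = 0 -> a * (1 - e) = a.
Proof. by move=> ae; rewrite mulrBr mulr1 ae subr0. Qed.

Lemma mul_idem_compl (R : pzRingType) (e : R) : e * e = e -> e * (1 - e) = 0.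
Proof. by move=> ee; rewrite mulrBr mulr1 ee subrr. Qed.

Lemma mul_compl_idem (R : pzRingType) (e : R) : e * e = e -> (1 - e) * e = 0.
Proof. by move=> ee; rewrite mulrBl mul1r ee subrr. Qed.

(** On the corner (1 - e) R (1 - e), phi is multiplicative up to the twist by
    the image of its unit: balance with b = 1 - e. *)
Lemma image_mul_twisted (R : pzRingType) (e : R) (phi : {additive R -> R}) a c :
    peirce_preserving e phi -> a * e = 0 -> e * c = 0 -> c * e = 0 ->
  phi (a * c) * phi (1 - e) = phi a * phi c.
Proof.
move=> pp ae ec ce; have ee := pp_idem pp.
rewrite (pp_balanced pp) ?mul_idem_compl //.
by rewrite (compl_idr ce).
Qed.

(** If phi c = 1 - e, the twisted multiplicativity applied to c c says that
    phi (c c) is a left inverse of phi (1 - e), and in the opposite ring that it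
    is a right inverse. *)
Lemma image_compl_invertible (R : pzRingType) (e : R)
    (phi : {additive R -> R}) :
    peirce_preserving e phi ->
  exists t, [/\ e * t = 0, t * e = 0, phi (1 - e) * t = 1 - e
    & t * phi (1 - e) = 1 - e].
Proof.
move=> pp; have ee := pp_idem pp; have [psi psiK phiK] := pp_bij pp.
have ef := mul_idem_compl ee; have fe := mul_compl_idem ee.
have [c0f c0e] : e * psi (1 - e) = 0 /\ psi (1 - e) * e = 0.
  by split; [apply/(pp_ann_r pp) | apply/(pp_ann_l pp)]; rewrite phiK.
have ff : (1 - e) * (1 - e) = 1 - e by rewrite compl_idl.
exists (phi (psi (1 - e) * psi (1 - e))).
have tz : phi (psi (1 - e) * psi (1 - e)) * phi (1 - e) = 1 - e.
  by rewrite (image_mul_twisted pp) // phiK.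
split=> //.
- by apply/(pp_ann_r pp); rewrite mulrA c0f mul0r.
- by apply/(pp_ann_l pp); rewrite -mulrA c0e mulr0.
- have := @image_mul_twisted R^c e phi (psi (1 - e)) (psi (1 - e))
    (peirce_preserving_op pp) c0f c0e c0f.
  by rewrite phiK => h; rewrite -[RHS]ff; exact: h.
Qed.

(** Write phi x = p + q with p in e R (1 - e) and q in the corner. The
    factorization (e + x)(e - x + (1 - e)) = e gives q (z - q) = 0 and
    p (z - q - (1 - e)) = 0, where z = phi (1 - e). As phi (x c) can be in the
    corner only if x c = 0, whatever annihilates p annihilates q; thus
    q (z - q - (1 - e)) = 0 as well, and subtraction leaves q = 0. *)
Lemma image_peirce_block (R : pzRingType) (e : R) (phi : {additive R -> R}) x :
    peirce_preserving e phi -> e * x = x -> x * e = 0 ->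
  e * phi x = phi x /\ phi x * phi (1 - e) = phi x.
Proof.
move=> pp ex xe; have ee := pp_idem pp; have [psi psiK phiK] := pp_bij pp.
have ef := mul_idem_compl ee; have fe := mul_compl_idem ee.
have [t [et te zt tz]] := image_compl_invertible pp.
set z := phi (1 - e) in zt tz *; set s := phi x.
have se : s * e = 0 by apply/(pp_ann_l pp).
have ez : e * z = 0 by apply/(pp_ann_r pp).
have ze : z * e = 0 by apply/(pp_ann_l pp).
have xx : x * x = 0 by rewrite -{2}ex mulrA xe mul0r.
have sz : s * z = e * s + s * s.
  have : (e + s) * (e - s + z) = e.
    rewrite -[in LHS](pp_fix pp) -!(raddfB, raddfD) (pp_prod pp) //.
    move: ef (compl_idr xe); move: (1 - e) => f ef xf.
    rewrite mulrDl !mulrDr !mulrN ee ex xe xx ef xf.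
    by rewrite subr0 addr0 add0r subrK.
  rewrite mulrDl !mulrDr !mulrN ee se ez add0r addr0 => h.
  apply: subr0_eq; apply: (addrI e); rewrite addr0 -[RHS]h opprD.
  by rewrite [s * z + _]addrC !addrA.
have [q Dq] : exists q, q = (1 - e) * s by exists ((1 - e) * s).
have sdec : s = e * s + q by rewrite Dq mulrBl mul1r addrC subrK.
have qe : q * e = 0 by rewrite Dq -mulrA se mulr0.
have eq0 : e * q = 0 by rewrite Dq mulrA ef mul0r.
have ss : s * s = s * q by rewrite {2}sdec mulrDr mulrA se mul0r add0r.
(* here p is e s *)
have annq c : e * c = 0 -> c * e = 0 -> e * s * c = 0 -> q * c = 0.
  move=> ec ce psc; set c1 := psi c.
  have ec1 : e * c1 = 0 by apply/(pp_ann_r pp); rewrite phiK.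
  have ce1 : c1 * e = 0 by apply/(pp_ann_l pp); rewrite phiK.
  have sc : s * c = q * c by rewrite sdec mulrDl psc add0r.
  have h : phi (x * c1) * z = q * c.
    by rewrite (image_mul_twisted pp) // phiK.
  have xc1e : x * c1 * e = 0 by rewrite -mulrA ce1 mulr0.
  have h2 : phi (x * c1) = q * c * t.
    rewrite -h -mulrA zt compl_idr //; exact/(pp_ann_l pp).
  have : e * (x * c1) = 0 by apply/(pp_ann_r pp); rewrite h2 !mulrA eq0 !mul0r.
  by rewrite mulrA ex => xc1; rewrite -h xc1 raddf0 mul0r.
have q0 : q = 0.
  have pz : e * s * (z - q - (1 - e)) = 0.
    rewrite !mulrBr -!mulrA sz mulrDr !mulrA ee mulr1.
    have -> : e * s * e = 0 by rewrite -mulrA se mulr0.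
    rewrite subr0.
    have -> : e * s * s = e * s * q by rewrite -!mulrA ss.
    by rewrite addrK subrr.
  have qz : q * (z - q) = 0.
    rewrite mulrBr Dq -[(1 - e) * s * z]mulrA sz mulrDr !mulrA fe mul0r add0r.
    by rewrite -!mulrA ss -Dq subrr.
  have : q * (z - q - (1 - e)) = 0.
    apply: annq => //; first by rewrite !mulrBr ez eq0 mulr1 ee !subrr.
    by rewrite !mulrBl ze qe mul1r ee !subrr.
  by rewrite mulrBr qz sub0r (compl_idr qe) => /eqP; rewrite oppr_eq0 => /eqP.
have es : e * s = s by rewrite [RHS]sdec q0 addr0.
by split=> //; rewrite sz es ss q0 mulr0 addr0.
Qed.

(** With w = y x and v the complement of u in the corner this is a factorization
    of e through both off-diagonal blocks. The variable w is kept independent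
    of y x because the lemma is applied to the images under phi too, where
    w = phi (y x). *)
Lemma cross_product (R : pzRingType) (e x y u v w : R) :
    e * e = e -> e * x = x -> x * e = 0 -> y * e = y -> e * y = 0 ->
    x * y = 0 -> u * e = 0 -> e * v = 0 -> u * v = 0 ->
    u * y = y -> x * v = x -> e * w = 0 -> x * w = 0 -> u * w = w ->
  (e + x - y + u) * (e - x + y + (v - w)) = e + (y * x - w).
Proof.
move=> ee ex xe ye ey xy ue ev uv uy xv ew xw uw.
have xx : x * x = 0 by rewrite -{2}ex mulrA xe mul0r.
have ux : u * x = 0 by rewrite -ex mulrA ue mul0r.
have yy : y * y = 0 by rewrite -{1}ye -mulrA ey mulr0.
have yv : y * v = 0 by rewrite -ye -mulrA ev mulr0.
have yw : y * w = 0 by rewrite -ye -mulrA ew mulr0.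
rewrite !(mulrDl, mulrDr, mulrN, mulNr) ee ex ey ev ew xe xx xy xv xw.
rewrite ye yy yv yw ue ux uy uv uw !(oppr0, addr0, add0r, opprK, subrK).
by rewrite [- y + _]addrC -!addrA addKr.
Qed.

Lemma image_mul_corner (R : pzRingType) (e : R) (phi : {additive R -> R}) a c :
    peirce_preserving e phi -> phi (1 - e) = 1 - e ->
    a * e = 0 -> e * c = 0 -> c * e = 0 ->
  phi a * phi c = phi (a * c).
Proof.
move=> pp fix_f ae ec ce; rewrite -(image_mul_twisted pp) // fix_f compl_idr //.
by apply/(pp_ann_l pp); rewrite -mulrA ce mulr0.
Qed.

Lemma image_corner_mul (R : pzRingType) (e : R) (phi : {additive R -> R}) c b :
    peirce_preserving e phi -> phi (1 - e) = 1 - e ->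
    e * b = 0 -> e * c = 0 -> c * e = 0 ->
  phi c * phi b = phi (c * b).
Proof.
move=> pp fix_f eb ec ce.
exact: (@image_mul_corner R^c e phi b c (peirce_preserving_op pp)).
Qed.

(** Preservation of the factorization of e given by [cross_product] turns the
    value e + (phi y phi x - phi (y x)) of the product of the images into e. *)
Lemma image_opposite_blocks (R : pzRingType) (e u x y : R)
    (phi : {additive R -> R}) :
    peirce_preserving e phi -> phi (1 - e) = 1 - e ->
    e * x = x -> x * e = 0 -> y * e = y -> e * y = 0 ->
    u * u = u -> u * e = 0 -> e * u = 0 -> u * y = y -> x * u = 0 ->
  phi y * phi x = phi (y * x).
Proof.
move=> pp fix_f ex xe ye ey uu ue eu uy xu; have ee := pp_idem pp.
have mulC a c := @image_mul_corner R e phi a c pp fix_f.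
have mulC' c b := @image_corner_mul R e phi c b pp fix_f.
have [eX _] := image_peirce_block pp ex xe.
have [Ye _] := @image_peirce_block R^c e phi y (peirce_preserving_op pp) ye ey.
have Xe : phi x * e = 0 by apply/(pp_ann_l pp).
have eY : e * phi y = 0 by apply/(pp_ann_r pp).
have xy0 : x * y = 0.
  by rewrite -ex -ye !mulrA -(mulrA e); exact: (pp_triangular pp).
have XY0 : phi x * phi y = 0.
  rewrite -eX -[phi y]Ye.
  by rewrite mulrA -(mulrA e); exact: (pp_triangular pp).
set v := 1 - e - u.
have ev : e * v = 0 by rewrite !mulrBr mulr1 ee eu !subrr.
have ve : v * e = 0 by rewrite !mulrBl mul1r ee ue !subrr.
have uv : u * v = 0 by rewrite !mulrBr mulr1 ue uu subr0 subrr.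
have xv : x * v = x by rewrite !mulrBr mulr1 xe xu !subr0.
(* v is made opaque, so that additivity does not expand phi v *)
move: v ev ve uv xv => v ev ve uv xv.
have eyx : e * (y * x) = 0 by rewrite mulrA ey mul0r.
have yxe : y * x * e = 0 by rewrite -mulrA xe mulr0.
have xyx : x * (y * x) = 0 by rewrite mulrA xy0 mul0r.
have uyx : u * (y * x) = y * x by rewrite mulrA uy.
have := pp_prod pp (etrans (cross_product ee ex xe ye ey xy0 ue ev uv uy xv
  eyx xyx uyx) _).
rewrite subrr addr0 !(raddfD, raddfN) (pp_fix pp) /= => /(_ erefl).
rewrite (@cross_product _ e (phi x) (phi y) (phi u)) //.
- by rewrite -[RHS]addr0 => /addrI/subr0_eq.
- exact/(pp_ann_l pp).
- exact/(pp_ann_r pp).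
- by rewrite mulC // uv raddf0.
- by rewrite mulC' // uy.
- by rewrite mulC // xv.
- exact/(pp_ann_r pp).
- by rewrite mulC // xyx raddf0.
- by rewrite mulC // uyx.
Qed.

(** The products that connect different Peirce components are zero, before and
    after phi; the others are covered by the twist-free corner products, by the
    linearity of phi on e A e = F e, and by [image_opposite_blocks], for which a
    single u serves all pairs of elements of the off-diagonal blocks. *)
Lemma peirce_preserving_multiplicative (F : fieldType) (A : algType F) (e u : A)
    (phi : {linear A -> A}) :
    peirce_preserving e phi -> phi (1 - e) = 1 - e ->
    (forall a, exists k, e * a * e = k *: e) ->
    u * u = u -> u * e = 0 -> e * u = 0 ->
    (forall y, e * y = 0 -> u * (y * e) = y * e) ->
    (forall x, x * e = 0 -> e * x * u = 0) ->
  forall a b, phi (a * b) = phi a * phi b.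
Proof.
move=> pp fix_f eAe uu ue eu uY Xu a b; have ee := pp_idem pp.
have ef := mul_idem_compl ee; have fe := mul_compl_idem ee.
pose f := 1 - e; have Df : f = 1 - e by [].
have ff : f * f = f by rewrite Df compl_idl.
have decl c : c = c * e + c * f by rewrite mulrBr mulr1 addrC subrK.
have decr c : c = e * c + f * c by rewrite mulrBl mul1r addrC subrK.
have phiX x : e * x = x -> x * e = 0 -> e * phi x = phi x.
  by move=> ex xe; have [] := image_peirce_block pp ex xe.
have phiY y : y * e = y -> e * y = 0 -> phi y * e = phi y.
  move=> ye ey.
  by have [] := @image_peirce_block A^c e phi y (peirce_preserving_op pp) ye ey.
move: f Df ef fe ff decl decr => f Df; rewrite -Df => ef fe ff decl decr.
have compress_l c : exists k y, [/\ c * e = k *: e + y, y * e = y & e * y = 0].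
  have [k ece] := eAe c; exists k, (f * c * e).
  split; first by rewrite {1}(decr c) mulrDl ece.
    by rewrite -!mulrA ee.
  by rewrite !mulrA ef !mul0r.
have compress_r d : exists l x, [/\ e * d = l *: e + x, e * x = x & x * e = 0].
  have [l ede] := eAe d; exists l, (e * d * f).
  split; first by rewrite {1}[e * d]decl ede.
    by rewrite !mulrA ee.
  by rewrite -!mulrA fe !mulr0.
have mul_e c d : phi (c * e) * phi (e * d) = phi (c * e * (e * d)).
  have [k [y [-> ye ey]]] := compress_l c.
  have [l [x [-> ex xe]]] := compress_r d.
  have uy : u * y = y by rewrite -ye uY.
  have xu : x * u = 0 by rewrite -ex Xu.
  rewrite !linearD !linearZ /= (pp_fix pp) !(mulrDl, mulrDr).
  rewrite -!(scalerAl, scalerAr) ee ex ye.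
  rewrite (phiX x ex xe) (phiY y ye ey).
  rewrite (image_opposite_blocks pp fix_f ex xe ye ey uu) //.
  by rewrite !linearD !linearZ /= (pp_fix pp).
have mul_f c d : c * e = 0 -> e * d = 0 -> phi c * phi d = phi (c * d).
  move=> ce ed; rewrite [d]decl !(mulrDr, raddfD) /=.
  have def0 : e * (d * f) = 0 by rewrite mulrA ed mul0r.
  have dfe : d * f * e = 0 by rewrite -mulrA fe mulr0.
  rewrite (image_mul_corner pp fix_f ce def0 dfe); congr (_ + _).
  have ede : e * (d * e) = 0 by rewrite mulrA ed mul0r.
  rewrite [c]decr !(mulrDl, raddfD) /=.
  have efc : e * (f * c) = 0 by rewrite mulrA ef mul0r.
  have fce : f * c * e = 0 by rewrite -mulrA ce mulr0.
  have ece : e * c * e = 0 by rewrite -mulrA ce mulr0.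
  have eec : e * (e * c) = e * c by rewrite mulrA ee.
  have dee : d * e * e = d * e by rewrite -mulrA ee.
  rewrite (image_corner_mul pp fix_f ede efc fce); congr (_ + _).
  have -> : e * c * (d * e) = 0.
    by rewrite !mulrA -(mulrA e); exact: (pp_triangular pp).
  rewrite raddf0 -(phiX _ eec ece) -(phiY _ dee ede) mulrA -(mulrA e).
  by apply: (pp_triangular pp); [apply/(pp_ann_l pp) | apply/(pp_ann_r pp)].
have mul_ef c d : phi (c * e) * phi (f * d) = 0.
  have [k [y [-> ye ey]]] := compress_l c.
  have eP : e * phi (f * d) = 0.
    by apply/(pp_ann_r pp); rewrite mulrA ef mul0r.
  rewrite linearD linearZ /= (pp_fix pp) -(phiY y ye ey) mulrDl -scalerAl.
  by rewrite -mulrA eP mulr0 scaler0 addr0.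
have mul_fe c d : phi (c * f) * phi (e * d) = 0.
  have [k [x [-> ex xe]]] := compress_r d.
  have Pe : phi (c * f) * e = 0.
    by apply/(pp_ann_l pp); rewrite -mulrA fe mulr0.
  rewrite linearD linearZ /= (pp_fix pp) -(phiX x ex xe) mulrDr -scalerAr.
  by rewrite mulrA Pe mul0r scaler0 addr0.
have -> : phi a * phi b = phi (a * e * (e * b)) + phi (a * f * (f * b)).
  rewrite {1}[a]decl {1}[b]decr !linearD /= !(mulrDl, mulrDr) mul_ef mul_fe.
  by rewrite mul_e addr0 add0r mul_f // ?mulrA ?ef ?mul0r // -mulrA fe mulr0.
rewrite -linearD /= !mulrA -[a * e * e]mulrA -[a * f * f]mulrA ee ff.
by rewrite -mulrDl -decl.
Qed.

(** * Matrix units of the triangular algebra *)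

Lemma trigmx_lower0 (F : fieldType) (n : nat) (a : 'T[F]_n) (i j : 'I_n) :
  (j < i)%N -> a i j = 0.
Proof. by case: a => M /= /upper_trig_mxP; apply. Qed.

Lemma trigmxP (F : fieldType) (n : nat) (a b : 'T[F]_n) :
  (forall i j, a i j = b i j) <-> a = b.
Proof. by split=> [ab|-> //]; apply/val_inj/matrixP. Qed.

Fact upper_part_subproof (F : fieldType) (n : nat) (M : 'M[F]_n) :
  (\matrix_(i, j) (M i j *+ (i <= j)%N)) \in upper_trig_mx F n.
Proof. by apply/upper_trig_mxP => i j ltji; rewrite mxE leqNgt ltji. Qed.

Definition upper_part (F : fieldType) (n : nat) (M : 'M[F]_n) : 'T[F]_n :=
  TrigMx (upper_part_subproof M).

Lemma upper_partE (F : fieldType) (n : nat) (M : 'M[F]_n) i j :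
  upper_part M i j = M i j *+ (i <= j)%N.
Proof. by rewrite mxE. Qed.

Lemma trigmxM (F : fieldType) (n : nat) (a b : 'T[F]_n.+1) i j :
  (a * b) i j = \sum_k a i k * b k j.
Proof. by rewrite mxE. Qed.

Lemma trigmxD (F : fieldType) (n : nat) (a b : 'T[F]_n.+1) i j :
  (a + b) i j = a i j + b i j.
Proof. by rewrite mxE. Qed.

Lemma trigmxN (F : fieldType) (n : nat) (a : 'T[F]_n.+1) i j :
  (- a) i j = - a i j.
Proof. by rewrite mxE. Qed.

Lemma trigmxZ (F : fieldType) (n : nat) k (a : 'T[F]_n.+1) i j :
  (k *: a) i j = k * a i j.
Proof. by rewrite mxE. Qed.

Lemma trigmx0 (F : fieldType) (n : nat) i j : (0 : 'T[F]_n.+1) i j = 0.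
Proof. by rewrite mxE. Qed.

Lemma trigmx1 (F : fieldType) (n : nat) i j :
  (1 : 'T[F]_n.+1) i j = (i == j)%:R.
Proof. by rewrite mxE. Qed.

Definition trigmxE := (trigmxD, trigmxN, trigmxZ, trigmx0, trigmx1).

Definition trig_unit (F : fieldType) (n : nat) (k l : 'I_n.+1) : 'T[F]_n.+1 :=
  upper_part (delta_mx k l).

Lemma mul_trig_unit (F : fieldType) (n : nat) (a : 'T[F]_n.+1)
    (k l i j : 'I_n.+1) :
  (k <= l)%N -> (a * trig_unit F k l) i j = a i k *+ (j == l).
Proof.
move=> lekl; rewrite trigmxM (bigD1 k) //= upper_partE mxE eqxx /= big1.
  by case: eqP => [->|_]; rewrite ?lekl ?mul0rn ?mulr1 ?mulr0 addr0.
by move=> m mk; rewrite upper_partE mxE (negbTE mk) mul0rn mulr0.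
Qed.

Lemma trig_unit_mul (F : fieldType) (n : nat) (a : 'T[F]_n.+1)
    (k l i j : 'I_n.+1) :
  (k <= l)%N -> (trig_unit F k l * a) i j = a l j *+ (i == k).
Proof.
move=> lekl; rewrite trigmxM (bigD1 l) //= upper_partE mxE eqxx /= big1.
  by case: eqP => [->|_]; rewrite ?lekl ?mul0rn ?mul1r ?mul0r addr0.
by move=> m mk; rewrite upper_partE mxE (negbTE mk) andbF mul0rn mul0r.
Qed.

Lemma trig_unitE (F : fieldType) (n : nat) (k l i j : 'I_n.+1) :
  (k <= l)%N -> trig_unit F k l i j = ((i == k) && (j == l))%:R.
Proof.
move=> lekl; rewrite upper_partE mxE.
by case: andP => [[/eqP-> /eqP->]|_]; rewrite ?lekl ?mul0rn.
Qed.

Notation diag_unit F i := (trig_unit F i i).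

Lemma mul_diag_unit (F : fieldType) (n : nat) (a : 'T[F]_n.+1) i k l :
  (a * diag_unit F i) k l = a k i *+ (l == i).
Proof. exact: mul_trig_unit. Qed.

Lemma diag_unit_mul (F : fieldType) (n : nat) (a : 'T[F]_n.+1) i k l :
  (diag_unit F i * a) k l = a i l *+ (k == i).
Proof. exact: trig_unit_mul. Qed.

Lemma mul_diag_unit_eq0 (F : fieldType) (n : nat) (a : 'T[F]_n.+1) i :
  a * diag_unit F i = 0 <-> forall k, a k i = 0.
Proof.
split=> [/trigmxP ae k|a0].
  by have := ae k i; rewrite mul_diag_unit eqxx trigmx0.
by apply/trigmxP => k l; rewrite mul_diag_unit a0 mul0rn trigmx0.
Qed.

Lemma diag_unit_mul_eq0 (F : fieldType) (n : nat) (a : 'T[F]_n.+1) i :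
  diag_unit F i * a = 0 <-> forall k, a i k = 0.
Proof.
split=> [/trigmxP ae k|a0].
  by have := ae i k; rewrite diag_unit_mul eqxx trigmx0.
by apply/trigmxP => k l; rewrite diag_unit_mul a0 mul0rn trigmx0.
Qed.

Lemma diag_unit_idem (F : fieldType) (n : nat) (i : 'I_n.+1) :
  diag_unit F i * diag_unit F i = diag_unit F i.
Proof.
apply/trigmxP => k l; rewrite mul_diag_unit !trig_unitE // eqxx andbT.
by case: (k == i); case: (l == i).
Qed.

Lemma diag_unit_corner (F : fieldType) (n : nat) (i : 'I_n.+1)
    (a : 'T[F]_n.+1) :
  diag_unit F i * a * diag_unit F i = a i i *: diag_unit F i.
Proof.
apply/trigmxP => k l; rewrite trigmxZ mul_diag_unit diag_unit_mul trig_unitE //.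
by case: (k == i); case: (l == i); rewrite /= ?mulr1n ?mulr0n ?mulr1 ?mulr0.
Qed.

Lemma diag_unit_triangular (F : fieldType) (n : nat) (i : 'I_n.+1)
    (a b : 'T[F]_n.+1) :
    a * diag_unit F i = 0 -> diag_unit F i * b = 0 ->
  diag_unit F i * (a * b) * diag_unit F i = 0.
Proof.
move=> /mul_diag_unit_eq0 ae _.
rewrite diag_unit_corner trigmxM big1 ?scale0r //.
move=> m _; have [lemi|ltim|/val_inj ->] := ltngtP m i.
- by rewrite trigmx_lower0 ?mul0r.
- by rewrite [b m i]trigmx_lower0 ?mulr0.
- by rewrite ae mul0r.
Qed.

Lemma trigmx_sum_unit (F : fieldType) (n : nat) (a : 'T[F]_n.+1) :
  a = \sum_k \sum_l a k l *: trig_unit F k l.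
Proof.
have sumE I (r : seq I) (G : I -> 'T[F]_n.+1) i j :
    (\sum_(x <- r) G x) i j = \sum_(x <- r) G x i j.
  by elim/big_ind2: _ => [|b p c q <- <-|//]; rewrite trigmxE.
apply/trigmxP => i j; rewrite sumE.
rewrite (bigD1 i) //= [X in _ + X]big1 ?addr0; last first.
  move=> k ki; rewrite sumE big1 // => l _.
  by rewrite trigmxZ upper_partE mxE eq_sym (negbTE ki) mul0rn mulr0.
rewrite sumE (bigD1 j) //= [X in _ + X]big1 ?addr0; last first.
  move=> l lj; rewrite !mxE [j == l]eq_sym (negbTE lj).
  by rewrite andbF mul0rn mulr0.
rewrite !mxE !eqxx; case: leqP => [_|lt]; rewrite ?mulr1 //.
by rewrite trigmx_lower0 ?mul0r.
Qed.

(** For an idempotent c = u of the corner, the zero products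
    (a u)(b - u b) and (a - a u)(u b) give the identity, and the corner is
    spanned by its idempotents. *)
Lemma balanced_of_zero_product (F : fieldType) (n : nat) (i : 'I_n.+1)
    (phi : {linear 'T[F]_n.+1 -> 'T[F]_n.+1}) (e := diag_unit F i) :
    (forall a b, a * e = 0 -> e * b = 0 -> a * b = 0 -> phi a * phi b = 0) ->
  forall a b c, a * e = 0 -> e * b = 0 -> c * e = 0 -> e * c = 0 ->
    phi (a * c) * phi b = phi a * phi (c * b).
Proof.
move=> zp a b c ae eb ce ec.
pose P c := phi (a * c) * phi b = phi a * phi (c * b).
have P0 : P 0 by rewrite /P mulr0 mul0r !raddf0 mul0r mulr0.
have PD x y : P x -> P y -> P (x + y).
  by rewrite /P mulrDr mulrDl !raddfD mulrDl mulrDr => -> ->.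
have PZ k x : P x -> P (k *: x).
  by rewrite /P -scalerAr -scalerAl !linearZ /= -scalerAr -scalerAl => ->.
have Pidem u : u * u = u -> u * e = 0 -> e * u = 0 -> P u.
  move=> uu ue eu; have au : a * u * e = 0 by rewrite -mulrA ue mulr0.
  have ub : e * (u * b) = 0 by rewrite mulrA eu mul0r.
  have h1 : phi (a * u) * phi (b - u * b) = 0.
    apply: zp; rewrite // mulrBr ?eb ?ub ?subrr //.
    by rewrite -!mulrA (mulrA u u) uu subrr.
  have h2 : phi (a - a * u) * phi (u * b) = 0.
    apply: zp; rewrite // mulrBl ?ae ?au ?subrr //.
    by rewrite -!mulrA (mulrA u u) uu subrr.
  move: h1 h2; rewrite !raddfB mulrBr mulrBl => /subr0_eq h1 /subr0_eq h2.
  by rewrite /P h1 h2.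
have Pdiag k : k != i -> P (diag_unit F k).
  move=> ki; apply: Pidem; first exact: diag_unit_idem.
    apply/mul_diag_unit_eq0 => m; rewrite trig_unitE // [i == k]eq_sym.
    by rewrite (negbTE ki) andbF.
  apply/diag_unit_mul_eq0 => m; rewrite trig_unitE // [i == k]eq_sym.
  by rewrite (negbTE ki).
have Punit k l : k != i -> l != i -> P (trig_unit F k l).
  move=> ki li; have [ltkl|ltlk|/val_inj <-] := ltngtP k l; last exact: Pdiag.
    (* e_kl is a difference of the idempotents e_kk + e_kl and e_kk *)
    have -> : trig_unit F k l
        = (diag_unit F k + trig_unit F k l) + (- 1) *: diag_unit F k.
      by rewrite scaleN1r addrC addKr.
    have lekl := ltnW ltkl.
    apply: PD; last exact/PZ/Pdiag.
    apply: Pidem.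
    - apply/trigmxP => p q; rewrite mulrDr [LHS]trigmxD.
      rewrite mul_diag_unit mul_trig_unit //.
      rewrite !trigmxD !trig_unitE // eqxx andbT.
      rewrite [k == l]negbTE ?(ltn_eqF ltkl) //.
        by rewrite andbF addr0; do 3!case: eqP => //.
      by rewrite -val_eqE /= ltn_eqF.
    - apply/mul_diag_unit_eq0 => m; rewrite trigmxD !trig_unitE //.
      by rewrite ![i == _]eq_sym (negbTE ki) (negbTE li) !andbF addr0.
    - apply/diag_unit_mul_eq0 => m; rewrite trigmxD !trig_unitE //.
      by rewrite ![i == _]eq_sym (negbTE ki) addr0.
  have -> // : trig_unit F k l = 0.
  apply/trigmxP => p q; rewrite upper_partE mxE trigmx0.
  by case: eqP => [->|_]; case: eqP => [->|_]; rewrite ?mul0rn // leqNgt ltlk.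
move/mul_diag_unit_eq0: ce => ce; move/diag_unit_mul_eq0: ec => ec.
rewrite -/(P c) [c]trigmx_sum_unit.
apply: (big_ind P) => // k _; apply: (big_ind P) => // l _.
have [->|ki] := eqVneq k i; first by rewrite ec scale0r.
have [->|li] := eqVneq l i; first by rewrite ce scale0r.
exact/PZ/Punit.
Qed.

(** Commuting with the e_kk makes z diagonal, and commuting with the e_kl, for
    k < l, makes its diagonal entries outside position i equal. *)
Lemma corner_center (F : fieldType) (n : nat) (i : 'I_n.+1) (z : 'T[F]_n.+1)
    (e := diag_unit F i) :
    z * e = 0 -> e * z = 0 ->
    (forall c, c * e = 0 -> e * c = 0 -> z * c = c * z) ->
  exists k, z = k *: (1 - e).
Proof.
move=> /mul_diag_unit_eq0 ze /diag_unit_mul_eq0 ez zC.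
have entries k l k' l' : k != i -> l != i -> (k <= l)%N ->
    z k' k *+ (l' == l) = z l l' *+ (k' == k).
  move=> ki li lekl; rewrite -mul_trig_unit // -trig_unit_mul // zC //.
    apply/mul_diag_unit_eq0 => m; rewrite trig_unitE //.
    by rewrite [i == l]eq_sym (negbTE li) andbF.
  apply/diag_unit_mul_eq0 => m; rewrite trig_unitE //.
  by rewrite [i == k]eq_sym (negbTE ki).
have off k l : k != l -> z k l = 0.
  move=> kl; have [->|li] := eqVneq l i; first exact: ze.
  by have := entries l l k l li li (leqnn l); rewrite eqxx (negbTE kl).
have diag k l : k != i -> l != i -> z k k = z l l.
  wlog lekl : k l / (k <= l)%N.
    by move=> w ki li; case/orP: (leq_total k l) => h; [|symmetry]; apply: w.
  by move=> ki li; have := entries k l k l ki li lekl; rewrite !eqxx.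
have [k0 k0i|all_i] := pickP (predC1 i).
  exists (z k0 k0); apply/trigmxP => k l.
  rewrite trigmxZ !trigmxE trig_unitE //.
  have [<-|kl] := eqVneq k l; last first.
    rewrite off // (_ : _ && _ = false) ?subrr ?mulr0 //.
    by apply/andP=> -[/eqP ki /eqP li]; rewrite ki li eqxx in kl.
  rewrite andbb; have [->|ki] := eqVneq k i; first by rewrite ze subrr mulr0.
  by rewrite subr0 mulr1; apply: diag.
exists 0; apply/trigmxP => k l; rewrite scale0r trigmx0.
by have /eqP -> := negbFE (all_i l); rewrite ze.
Qed.

(** A surjection of F^m onto F^k, induced by phi on the quotients by ker p and
    ker q, bounds k by m and is injective when k = m. The sections s and t
    allow the argument to be carried out with matrices. *)
Lemma coord_surjection (F : fieldType) (V W : lmodType F) (m k : nat)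
    (phi : {linear V -> W}) (p : {linear V -> 'rV[F]_m})
    (s : {linear 'rV[F]_m -> V}) (q : {linear W -> 'rV[F]_k})
    (t : 'rV[F]_k -> W) :
    bijective phi -> cancel s p -> cancel t q ->
    (forall a, p a = 0 -> q (phi a) = 0) ->
  (k <= m)%N /\ (k = m -> forall a, q (phi a) = 0 -> p a = 0).
Proof.
move=> [psi psiK phiK] sK tK ker.
have factor a : q (phi (s (p a))) = q (phi a).
  have : q (phi (s (p a) - a)) = 0 by apply: ker; rewrite linearB /= sK subrr.
  by rewrite !linearB => /subr0_eq.
pose M := lin1_mx (q \o phi \o s).
pose N := \matrix_j p (psi (t (delta_mx 0 j))).
have NM : N *m M = 1%:M.
  apply/row_matrixP => j.
  by rewrite row_mul rowK mul_rV_lin1 /= factor phiK tK row1.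
split; first exact: mulmx1_min NM.
move=> km; subst k; move=> a qa0.
have paM : p a *m M = 0 by rewrite mul_rV_lin1 /= factor.
by rewrite -[p a]mulmx1 -(mulmx1C NM) mulmxA paM mul0mx.
Qed.

(** * The annihilators of a diagonal matrix unit *)

(** The left annihilator of e_i is the kernel of the i-th column, whose rows
    0, ..., i are free; the right annihilator is the kernel of the i-th row,
    whose columns i, ..., n are free. *)
Section Coordinates.
Variables (F : fieldType) (n : nat) (i : 'I_n.+1).

Definition col_coord (a : 'T[F]_n.+1) : 'rV[F]_i.+1 :=
  \row_k a (inord k) i.
Definition col_section (v : 'rV[F]_i.+1) : 'T[F]_n.+1 :=
  upper_part (\matrix_(k, l) (v 0 (inord k) *+ (l == i))).
Definition row_coord (a : 'T[F]_n.+1) : 'rV[F]_(n - i).+1 :=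
  \row_k a i (inord (i + k)).
Definition row_section (v : 'rV[F]_(n - i).+1) : 'T[F]_n.+1 :=
  upper_part (\matrix_(k, l) (v 0 (inord (l - i)) *+ (k == i))).

Fact col_coord_linear : linear col_coord.
Proof. by move=> k a b; apply/rowP => j; rewrite !mxE. Qed.
Fact row_coord_linear : linear row_coord.
Proof. by move=> k a b; apply/rowP => j; rewrite !mxE. Qed.
Fact col_section_linear : linear col_section.
Proof.
move=> k a b; apply/trigmxP => p q; rewrite !trigmxE !upper_partE !mxE.
by case: (q == i); case: (p <= q)%N; rewrite ?mulr0n ?mulr1n ?mulr0 ?addr0.
Qed.
Fact row_section_linear : linear row_section.
Proof.
move=> k a b; apply/trigmxP => p q; rewrite !trigmxE !upper_partE !mxE.
by case: (p == i); case: (p <= q)%N; rewrite ?mulr0n ?mulr1n ?mulr0 ?addr0.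
Qed.

HB.instance Definition _ := GRing.isLinear.Build F _ _ _ col_coord
  col_coord_linear.
HB.instance Definition _ := GRing.isLinear.Build F _ _ _ row_coord
  row_coord_linear.
HB.instance Definition _ := GRing.isLinear.Build F _ _ _ col_section
  col_section_linear.
HB.instance Definition _ := GRing.isLinear.Build F _ _ _ row_section
  row_section_linear.

Lemma col_sectionK : cancel col_section col_coord.
Proof.
move=> v; apply/rowP => k; rewrite mxE upper_partE mxE eqxx mulr1n.
have kn : (k < n.+1)%N by apply: leq_trans (ltn_ord k) (ltn_ord i).
have vk : (inord k : 'I_n.+1) = k :> nat by exact: inordK.
have leki : (k <= i)%N by rewrite -ltnS ltn_ord.
by rewrite vk leki inord_val.
Qed.

Lemma row_sectionK : cancel row_section row_coord.
Proof.
move=> v; apply/rowP => k; rewrite mxE upper_partE mxE eqxx mulr1n.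
have kn : (i + k < n.+1)%N.
  by rewrite ltnS -leq_subRL -ltnS ltn_ord.
have vk : (inord (i + k) : 'I_n.+1) = (i + k)%N :> nat by exact: inordK.
by rewrite vk leq_addr addKn inord_val.
Qed.

Lemma col_coord_eq0 a : col_coord a = 0 <-> a * diag_unit F i = 0.
Proof.
split=> [/rowP a0|/mul_diag_unit_eq0 a0]; last first.
  by apply/rowP => k; rewrite !mxE.
apply/mul_diag_unit_eq0 => k.
have [leki|ltik] := leqP k i; last exact: trigmx_lower0.
have vk : (inord k : 'I_i.+1) = k :> nat by exact: inordK.
by have := a0 (inord k); rewrite !mxE vk inord_val.
Qed.

Lemma row_coord_eq0 a : row_coord a = 0 <-> diag_unit F i * a = 0.
Proof.
split=> [/rowP a0|/diag_unit_mul_eq0 a0]; last first.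
  by apply/rowP => k; rewrite !mxE.
apply/diag_unit_mul_eq0 => k.
have [leik|ltki] := leqP i k; last exact: trigmx_lower0.
have kn : (k - i < (n - i).+1)%N by rewrite ltnS leq_sub2r // -ltnS.
have vk : (inord (k - i) : 'I_(n - i).+1) = (k - i)%N :> nat by exact: inordK.
by have := a0 (inord (k - i)); rewrite !mxE vk subnKC // inord_val.
Qed.

End Coordinates.

(** Since (phi e_i)^2 = e_j, an element that annihilates phi e_i annihilates
    e_j. The left annihilators have codimensions i + 1 and j + 1, the right ones
    n - i + 1 and n - j + 1, which bounds j by i and i by j; equality of the
    codimensions then turns the inclusions into equivalences. *)
Lemma diag_unit_matching (F : fieldType) (n : nat) (i j : 'I_n.+1)
    (phi : {linear 'T[F]_n.+1 -> 'T[F]_n.+1}) :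
    bijective phi ->
    preserves_products_equal_to (diag_unit F i) (diag_unit F j) phi ->
  [/\ i = j,
      forall a, phi a * diag_unit F i = 0 <-> a * diag_unit F i = 0
    & forall a, diag_unit F i * phi a = 0 <-> diag_unit F i * a = 0].
Proof.
move=> bij prod; have ee := diag_unit_idem F i.
have annl a : a * diag_unit F i = 0 -> phi a * diag_unit F j = 0.
  move=> ae; have [ff af _ _] :=
    factorization_zero_products ee prod ae (mulr0 _) (mulr0 _).
  by rewrite -ff mulrA af mul0r.
have annr a : diag_unit F i * a = 0 -> diag_unit F j * phi a = 0.
  move=> ea; have [ff _ fa _] :=
    factorization_zero_products ee prod (mul0r _) ea (mul0r _).
  by rewrite -ff -mulrA fa mulr0.
have [leji annl'] := coord_surjection bij (@col_sectionK F n i)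
  (@col_sectionK F n j)
  (fun a a0 => (col_coord_eq0 _ _).2 (annl a ((col_coord_eq0 _ _).1 a0))).
have [leij annr'] := coord_surjection bij (@row_sectionK F n i)
  (@row_sectionK F n j)
  (fun a a0 => (row_coord_eq0 _ _).2 (annr a ((row_coord_eq0 _ _).1 a0))).
have eij : i = j.
  apply/val_inj/eqP; rewrite eqn_leq; apply/andP; split; last exact: leji.
  by move: leij; rewrite ltnS leq_sub2lE // -ltnS.
subst j; split=> // a; split=> [|ae].
- by move=> /col_coord_eq0 /(annl' erefl) /col_coord_eq0.
- exact: annl.
- by move=> /row_coord_eq0 /(annr' erefl) /row_coord_eq0.
- exact: annr.
Qed.

(** By surjectivity 1 - e is the image of an element that annihilates e, so it
    annihilates phi e on either side. Hence phi e lies in e T e = F e, and its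
    square is e. *)
Lemma image_diag_unit (F : fieldType) (n : nat) (i : 'I_n.+1)
    (phi : {linear 'T[F]_n.+1 -> 'T[F]_n.+1}) (e := diag_unit F i) :
    bijective phi -> preserves_products_equal_to e e phi ->
    (forall a, phi a * e = 0 <-> a * e = 0) ->
    (forall a, e * phi a = 0 <-> e * a = 0) ->
  phi e = e \/ phi e = - e.
Proof.
move=> [psi psiK phiK] prod annl annr.
have ee : e * e = e := diag_unit_idem F i.
have ff : phi e * phi e = e by exact: prod.
have fg : (1 - e) * phi e = 0.
  have ae : psi (1 - e) * e = 0 by apply/annl; rewrite phiK mul_compl_idem.
  have [_ h _ _] := factorization_zero_products ee prod ae (mulr0 _) (mulr0 _).
  by rewrite -{1}(phiK (1 - e)).
have gf : phi e * (1 - e) = 0.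
  have ea : e * psi (1 - e) = 0 by apply/annr; rewrite phiK mul_idem_compl.
  have [_ _ h _] := factorization_zero_products ee prod (mul0r _) ea (mul0r _).
  by rewrite -{1}(phiK (1 - e)).
have ge : phi e = phi e * e.
  by apply: subr0_eq; rewrite -{1}[phi e]mulr1 -mulrBr.
have eg : phi e = e * phi e.
  by apply: subr0_eq; rewrite -{1}[phi e]mul1r -mulrBl.
have [c Dc] : exists c, phi e = c *: e.
  exists (phi e i i); rewrite {1}ge {1}eg; exact: diag_unit_corner.
have : (c ^+ 2) *: e = e.
  by rewrite -[RHS]ff Dc -scalerAl -scalerAr scalerA ee.
move/trigmxP/(_ i i); rewrite trigmxZ trig_unitE // !eqxx mulr1 => /eqP.
rewrite sqrf_eq1 Dc => /orP[]/eqP->; first by left; rewrite scale1r.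
by right; rewrite scaleN1r.
Qed.

(** * Multiplicativity *)

Lemma multiplicative_of_fixed_diag_unit (F : fieldType) (n : nat)
    (i : 'I_n.+1) (phi : {linear 'T[F]_n.+1 -> 'T[F]_n.+1})
    (e := diag_unit F i) :
    bijective phi -> preserves_products_equal_to e e phi ->
    phi e = e ->
    (forall a, phi a * e = 0 <-> a * e = 0) ->
    (forall a, e * phi a = 0 <-> e * a = 0) ->
  monoid_morphism phi.
Proof.
move=> bij prod fix_e annl annr; have ee : e * e = e := diag_unit_idem F i.
have pp : peirce_preserving e phi.
  split=> //; first exact: diag_unit_triangular.
  apply: balanced_of_zero_product => a b ae eb ab.
  by have [] := factorization_zero_products ee prod ae eb ab.
have ef := mul_idem_compl ee; have fe := mul_compl_idem ee.
have [psi psiK phiK] := bij.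
have ez : e * phi (1 - e) = 0 by apply/annr.
have ze : phi (1 - e) * e = 0 by apply/annl.
have [k Dz] : exists k, phi (1 - e) = k *: (1 - e).
  apply: corner_center => // c ce ec.
  have ec1 : e * psi c = 0 by apply/annr; rewrite phiK.
  have ce1 : psi c * e = 0 by apply/annl; rewrite phiK.
  rewrite -(phiK c) -(image_mul_twisted pp ce1 ef fe) -/e.
  have := image_mul_twisted pp fe ec1 ce1.
  by rewrite !(compl_idr ce1) !(compl_idl ec1).
(* the scalar k is 1 because it fixes the image of some off-diagonal e_pq *)
have fix_f : phi (1 - e) = 1 - e.
  have scal (x : 'T[F]_n.+1) : x != 0 -> k *: phi x = phi x -> k = 1.
    move=> x0 kx; apply/eqP; rewrite -subr_eq0; apply: contraR x0 => k1.
    apply/eqP; apply: (can_inj psiK); rewrite raddf0.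
    apply: (scalerI k1).
    by rewrite scaler0 scalerBl kx scale1r subrr.
  have unit0 (p q : 'I_n.+1) : (p <= q)%N -> trig_unit F p q != 0.
    move=> lepq; apply/eqP => /trigmxP/(_ p q).
    by rewrite trig_unitE // !eqxx trigmx0 => /eqP; rewrite oner_eq0.
  have [k0 k0i|all_i] := pickP (predC1 i); last first.
    have -> : 1 - e = 0; last by rewrite raddf0.
    apply/trigmxP => p q; rewrite !trigmxE trig_unitE //.
    have /eqP-> := negbFE (all_i p); have /eqP-> := negbFE (all_i q).
    by rewrite eqxx subrr.
  rewrite /= in k0i; have [ltik|ltki|/val_inj eq_ik] := ltngtP i k0; last first.
  - by rewrite eq_ik eqxx in k0i.
  - pose y := trig_unit F k0 i.
    have ye : y * e = y.
      apply/trigmxP=> p q; rewrite mul_diag_unit !trig_unitE // 1?ltnW //.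
      by rewrite eqxx andbT; case: (q == i); rewrite ?andbT ?andbF ?mulr0n.
    have ey : e * y = 0.
      apply/diag_unit_mul_eq0=> q; rewrite trig_unitE // 1?ltnW //.
      by rewrite [i == k0]eq_sym (negbTE k0i).
    have [_ zY] := @image_peirce_block ('T[F]_n.+1)^c e phi y
      (peirce_preserving_op pp) ye ey.
    have {}zY : phi (1 - e) * phi y = phi y by [].
    have ann : e * phi y = 0 by apply/annr.
    rewrite Dz (scal y) ?scale1r ?unit0 1?ltnW //.
    by rewrite -[RHS]zY Dz -scalerAl (compl_idl ann).
  - pose x := trig_unit F i k0.
    have ex : e * x = x.
      apply/trigmxP=> p q; rewrite diag_unit_mul !trig_unitE // 1?ltnW //.
      by rewrite eqxx /=; case: (p == i); rewrite ?mulr0n.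
    have xe : x * e = 0.
      apply/mul_diag_unit_eq0=> q; rewrite trig_unitE // 1?ltnW //.
      by rewrite [i == k0]eq_sym (negbTE k0i) andbF.
    have [_ Xz] := image_peirce_block pp ex xe.
    have {}Xz : phi x * phi (1 - e) = phi x by [].
    have ann : phi x * e = 0 by apply/annl.
    rewrite Dz (scal x) ?scale1r ?unit0 1?ltnW //.
    by rewrite -[RHS]Xz Dz -scalerAr (compl_idr ann).
split; first by rewrite -(subrK e 1) raddfD /= fix_f fix_e.
(* u acts as the identity on column i above the diagonal, and kills row i
   right of the diagonal *)
pose u : 'T[F]_n.+1 := upper_part (\matrix_(p, q) ((p == q) && (p < i)%N)%:R).
have uE p q : u p q = ((p == q) && (p < i)%N)%:R.
  by rewrite upper_partE mxE; case: eqP => [->|]; rewrite ?leqnn ?mul0rn.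
have umul a p q : (u * a) p q = a p q *+ (p < i)%N.
  rewrite trigmxM (bigD1 p) //= uE eqxx big1 ?addr0 => [|r rp].
    by case: (p < i)%N; rewrite ?mul1r ?mul0r.
  by rewrite uE eq_sym (negbTE rp) mul0r.
have mulu a p q : (a * u) p q = a p q *+ (q < i)%N.
  rewrite trigmxM (bigD1 q) //= uE eqxx big1 ?addr0 => [|r rp].
    by case: (q < i)%N; rewrite ?mulr1 ?mulr0.
  by rewrite uE (negbTE rp) mulr0.
apply: (@peirce_preserving_multiplicative F ('T[F]_n.+1) e u phi) => //.
- by move=> a; exists (a i i); apply: diag_unit_corner.
- by apply/trigmxP => p q; rewrite umul uE; case: (p < i)%N; rewrite ?andbF.
- by apply/mul_diag_unit_eq0 => p; rewrite uE; case: eqP => // ->; rewrite ltnn.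
- by apply/diag_unit_mul_eq0 => p; rewrite uE ltnn andbF.
- move=> y /diag_unit_mul_eq0 ey; apply/trigmxP => p q.
  rewrite umul mul_diag_unit; have [//|ltip|/val_inj ->] := ltngtP p i.
    by rewrite trigmx_lower0 // mul0rn.
  by rewrite ey mul0rn.
- move=> x xe; apply/trigmxP => p q.
  rewrite mulu diag_unit_mul trigmx0; have [ltqi|//] := ltnP q i.
  by rewrite trigmx_lower0 // !mul0rn.
Qed.

(** * Conjugacy of idempotents *)

Lemma lrmorphism_of (F : fieldType) (A : algType F) (f : A -> A) :
  linear f -> monoid_morphism f -> exists g : {lrmorphism A -> A}, g =1 f.
Proof.
move=> f_lin f_mul.
pose fL := GRing.isLinear.Build F _ _ _ f f_lin.
pose fM := GRing.isMonoidMorphism.Build _ _ f f_mul.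
pose g : {lrmorphism A -> A} := HB.pack f fL fM.
by exists g.
Qed.

Lemma scaler_bij (F : fieldType) (V : lmodType F) (c : F) :
  c * c = 1 -> bijective ( *:%R c : V -> V).
Proof. by move=> c1; exists ( *:%R c) => x; rewrite scalerA c1 scale1r. Qed.

Lemma strict_upper_nilpotent (F : fieldType) (n : nat) (a : 'T[F]_n.+1) :
  (forall i, a i i = 0) -> a ^+ n.+1 = 0.
Proof.
move=> a0; have shift m (i j : 'I_n.+1) : (j < i + m)%N -> (a ^+ m) i j = 0.
  elim: m i j => [|m IHm] i j; first by rewrite addn0; apply: trigmx_lower0.
  rewrite addnS ltnS => lejim; rewrite exprS trigmxM big1 // => k _.
  have [ltki|ltik|/val_inj <-] := ltngtP k i.
  - by rewrite trigmx_lower0 ?mul0r.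
  - by rewrite IHm ?mulr0 // (leq_ltn_trans lejim) // ltn_add2r.
  - by rewrite a0 mul0r.
apply/trigmxP => i j; rewrite trigmx0; apply: shift.
exact: leq_trans (ltn_ord j) (leq_addl _ _).
Qed.

Lemma unit_diag_inverse (F : fieldType) (n : nat) (a : 'T[F]_n.+1) :
  (forall i, a i i = 1) -> exists b, a * b = 1 /\ b * a = 1.
Proof.
move=> a1; pose b := \sum_(i < n.+1) (1 - a) ^+ i.
have nil : (1 - a) ^+ n.+1 = 0.
  by apply: strict_upper_nilpotent => i; rewrite !trigmxE a1 eqxx subrr.
have ab : a * b = 1.
  have := subrX1 (1 - a) n.+1; rewrite nil sub0r -/b addrAC subrr add0r mulNr.
  by move/oppr_inj.
exists b; split=> //; rewrite -[RHS]ab /b mulr_suml mulr_sumr.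
apply: eq_bigr => i _; apply/esym/commrX/commrB; last exact: commr_refl.
exact: commr1.
Qed.

(** Conjugation by u = e f + (1 - e)(1 - f), for which e u = e f = u f. *)
Lemma conjugate_of_same_diagonal (F : fieldType) (n : nat) (e f : 'T[F]_n.+1) :
    idempotent_elt e -> idempotent_elt f -> same_diagonal e f ->
  exists2 kappa : {lrmorphism 'T[F]_n.+1 -> 'T[F]_n.+1},
    bijective kappa & kappa e = f.
Proof.
move=> ee ff ef.
have diagM (a b : 'T[F]_n.+1) i : (a * b) i i = a i i * b i i.
  rewrite trigmxM (bigD1 i) //= big1 ?addr0 // => k ki.
  have [lt|lt|/val_inj eq_ki] := ltngtP k i; last by rewrite eq_ki eqxx in ki.
    by rewrite trigmx_lower0 ?mul0r.
  by rewrite [b k i]trigmx_lower0 ?mulr0.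
(* on the diagonal, u is x * x + (1 - x) * (1 - x) = 1 for x idempotent *)
pose u := e * f + (1 - e) * (1 - f).
have eu : e * u = u * f.
  rewrite [LHS]mulrDr [RHS]mulrDl !mulrA (mul_idem_compl ee) ee mul0r addr0.
  by rewrite -!mulrA (mul_compl_idem ff) ff mulr0 addr0.
have [v [uv vu]] : exists v, u * v = 1 /\ v * u = 1.
  apply: unit_diag_inverse => i; rewrite trigmxD !diagM !trigmxE eqxx -ef.
  have e2 : e i i * e i i = e i i by rewrite -diagM ee.
  by rewrite mulrBr mulr1 mulrBl mul1r !e2 subrr subr0 addrC subrK.
(* u is made opaque, so that distributivity does not expand it *)
move: u eu uv vu => u eu uv vu; pose kap (x : 'T[F]_n.+1) := v * x * u.
have kap_lin : linear kap.
  by move=> k x y; rewrite /kap mulrDr mulrDl -scalerAr -scalerAl.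
have kap_mul : monoid_morphism kap.
  split; first by rewrite /kap mulr1.
  by move=> x y; rewrite /kap !mulrA -[v * x * u * v]mulrA uv mulr1.
have [kappa kapE] := lrmorphism_of kap_lin kap_mul.
exists kappa.
  exists (fun x => u * x * v) => x; rewrite kapE /kap.
    by rewrite !mulrA uv mul1r -mulrA uv mulr1.
  by rewrite !mulrA vu mul1r -mulrA vu mulr1.
by rewrite kapE /kap -mulrA eu mulrA vu mul1r.
Qed.

(** The idempotent e is conjugate to its diagonal part d, which is therefore
    primitive too. But d is the orthogonal sum of the diagonal matrix unit at
    any of its nonzero entries, which equal 1, and of the rest of d. *)
Lemma primitive_diagonal (F : fieldType) (n : nat) (e : 'T[F]_n.+1) :
  primitive_idempotent e -> exists i, same_diagonal (diag_unit F i) e.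
Proof.
case=> ee e0 prim.
pose d : 'T[F]_n.+1 := upper_part (\matrix_(k, l) (e k k *+ (k == l))).
have dE k l : d k l = e k k *+ (k == l).
  by rewrite upper_partE mxE; case: eqP => [->|]; rewrite ?leqnn ?mul0rn.
have e2 k : e k k * e k k = e k k.
  rewrite -{3}ee trigmxM (bigD1 k) //= big1 ?addr0 // => l lk.
  have [lt|lt|/val_inj eq_lk] := ltngtP l k; last by rewrite eq_lk eqxx in lk.
    by rewrite trigmx_lower0 ?mul0r.
  by rewrite [e l k]trigmx_lower0 ?mulr0.
have dd : d * d = d.
  apply/trigmxP => k l; rewrite trigmxM (bigD1 k) //= big1 ?addr0.
    by rewrite !dE eqxx mulr1n mulrnAr e2.
  by move=> m mk; rewrite dE eq_sym (negbTE mk) mul0r.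
have de : same_diagonal d e by move=> k; rewrite dE eqxx.
have [kappa [kinv kK _] kd] := conjugate_of_same_diagonal dd ee de.
have [i ei] : exists i, e i i != 0.
  apply/existsP; apply: contraR e0 => /existsPn e0.
  rewrite -kd (_ : d = 0) ?raddf0 //; apply/trigmxP => k l.
  by rewrite dE (eqP (negPn (e0 k))) mul0rn trigmx0.
have ei1 : e i i = 1 by apply: (mulfI ei); rewrite e2 mulr1.
have di : d * diag_unit F i = diag_unit F i.
  apply/trigmxP => k l; rewrite mul_diag_unit dE trig_unitE //.
  by case: (eqVneq k i) => [->|]; case: (l == i); rewrite ?ei1 ?mul0rn.
have id : diag_unit F i * d = diag_unit F i.
  apply/trigmxP => k l; rewrite diag_unit_mul dE trig_unitE //.
  by rewrite ei1 eq_sym; case: (l == i); case: (k == i).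
have ii := diag_unit_idem F i.
have [] := prim (kappa (diag_unit F i)) (kappa (d - diag_unit F i)).
- by rewrite /idempotent_elt -rmorphM ii.
- by rewrite /idempotent_elt -rmorphM !(mulrBl, mulrBr) di id ii dd subrr subr0.
- by rewrite -rmorphM mulrBr id ii subrr raddf0.
- by rewrite -rmorphM mulrBl di ii subrr raddf0.
- by rewrite -[LHS]kd -rmorphD addrC subrK.
case=> [k0|ki] _.
  have /trigmxP/(_ i i) : diag_unit F i = 0.
    by apply: (can_inj kK); rewrite raddf0.
  by rewrite trig_unitE // !eqxx trigmx0 => /eqP; rewrite oner_eq0.
exists i; have -> : diag_unit F i = d by apply: (can_inj kK); rewrite ki kd.
exact: de.
Qed.

(** * Bijective maps that preserve the factorizations *)

Theorem corollary3p18 (F : fieldType) (n : nat) (eps eta : 'T[F]_n.+1)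
    (heps : primitive_idempotent eps) (heta : primitive_idempotent eta) :
  ((exists phi : {linear 'T[F]_n.+1 -> 'T[F]_n.+1},
      bijective phi /\ preserves_products_equal_to eps eta phi)
   <-> same_diagonal eps eta)
  /\
  (forall phi : {linear 'T[F]_n.+1 -> 'T[F]_n.+1},
     bijective phi -> preserves_products_equal_to eps eta phi ->
     exists psi : {lrmorphism 'T[F]_n.+1 -> 'T[F]_n.+1},
       bijective psi /\ (phi =1 psi \/ phi =1 (fun x => - psi x))).
Proof.
have [i epsi] := primitive_diagonal heps.
have [j etaj] := primitive_diagonal heta.
have [ee _ _] := heps; have [hh _ _] := heta.
have [ka ka_bij kaE] :=
  conjugate_of_same_diagonal (diag_unit_idem F i) ee epsi.
have [kb kb_bij kbE] :=
  conjugate_of_same_diagonal hh (diag_unit_idem F j) (fsym etaj).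
(* the scalar c, of square 1, will absorb the sign of phi *)
have conj_bij (c : F) (phi : {linear 'T[F]_n.+1 -> 'T[F]_n.+1}) :
    c * c = 1 -> bijective phi -> bijective (c \*: (kb \o phi \o ka)).
  move=> c1 bij.
  apply: bij_comp (@scaler_bij F 'T[F]_n.+1 c c1) _.
  exact: bij_comp (bij_comp kb_bij bij) ka_bij.
have conj_prod (c : F) (phi : {linear 'T[F]_n.+1 -> 'T[F]_n.+1}) :
    c * c = 1 -> preserves_products_equal_to eps eta phi ->
    preserves_products_equal_to (diag_unit F i) (diag_unit F j)
      (c \*: (kb \o phi \o ka)).
  move=> c1 prod a b ab; rewrite /= -scalerAl -scalerAr scalerA c1 scale1r.
  rewrite -rmorphM prod; first exact: kbE.
  by rewrite -kaE -ab rmorphM.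
split.
  split=> [[phi [bij prod]]|same].
    have [eij _ _] := diag_unit_matching (conj_bij 1 phi (mulr1 1) bij)
      (conj_prod 1 phi (mulr1 1) prod).
    by move=> k; rewrite -epsi -etaj eij.
  have [kappa kbij kE] := conjugate_of_same_diagonal ee hh same.
  by exists kappa; split=> // a b ab; rewrite -kE -ab rmorphM.
move=> phi bij prod.
have eij : i = j.
  by have [] := diag_unit_matching (conj_bij 1 phi (mulr1 1) bij)
    (conj_prod 1 phi (mulr1 1) prod).
rewrite -eij in conj_prod.
have [c [c1 c_sign fix_c]] : exists c : F, [/\ c * c = 1, c = 1 \/ c = - 1 &
    (c \*: (kb \o phi \o ka)) (diag_unit F i) = diag_unit F i].
  have [_ annl annr] := diag_unit_matching (conj_bij 1 phi (mulr1 1) bij)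
    (conj_prod 1 phi (mulr1 1) prod).
  have [] := image_diag_unit (conj_bij 1 phi (mulr1 1) bij)
    (conj_prod 1 phi (mulr1 1) prod) annl annr; rewrite /= scale1r => fix1.
    by exists 1; rewrite mulr1 scale1r; split; [|left|].
  by exists (- 1); rewrite mulrNN mulr1 scaleN1r fix1 opprK; split; [|right|].
have chi_bij := conj_bij c phi c1 bij.
have chi_prod := conj_prod c phi c1 prod.
have [_ annl annr] := diag_unit_matching chi_bij chi_prod.
have [chi1 chiM] :=
  multiplicative_of_fixed_diag_unit chi_bij chi_prod fix_c annl annr.
have [kainv kaK kainvK] := ka_bij.
(* chi is c phi transported by the conjugations ka and kb, so c phi is
   multiplicative as well *)
have psi_mul : monoid_morphism (c \*: phi).
  split.
    apply: (bij_inj kb_bij); rewrite [RHS]rmorph1 -[RHS]chi1 /= linearZ /=.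
    by congr (c *: kb (phi _)); rewrite rmorph1.
  move=> a b; apply: (bij_inj kb_bij).
  have := chiM (kainv a) (kainv b).
  rewrite /= rmorphM /= !kainvK => h.
  by rewrite [RHS]rmorphM /= !linearZ.
have psi_lin : linear (c \*: phi).
  by move=> k x y; rewrite /= linearP scalerDr !scalerA mulrC.
have [psi psiE] := lrmorphism_of psi_lin psi_mul.
have phiE x : phi x = c *: psi x by rewrite psiE /= scalerA c1 scale1r.
exists psi; split.
  exact: eq_bij (bij_comp (@scaler_bij F 'T[F]_n.+1 c c1) bij) _ (fsym psiE).
case: c_sign => c_eq; [left|right] => x; rewrite phiE c_eq.
  by rewrite scale1r.
by rewrite scaleN1r.
Qed.
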